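(* Let $\mathbb{F}\subset\mathbb{K}$ be fields of characteristic zero, let $n$ be a positive integer, let $\kappa\in\mathbb{K}$, and let $f\colon\mathbb{F}\to\mathbb{K}$ be a generalized monomial of degree $n$ such that \[ f(x^{2})=\kappa\cdot x^{n}f(x)\qquad (x\in\mathbb{F}). \] Then: (i) if $\kappa\notin\{2^{k}\mid k=0,1,\ldots,n\}$, then $f$ is identically zero; (ii) if $\kappa=1$, then $f(x)=f(1)\cdot x^{n}$ for all $x\in\mathbb{F}$; (iii) if $\kappa=2$, then there exist a derivation $a\colon\mathbb{F}\to\mathbb{K}$ of order $2n-1$ and constants $\lambda_{n,1},\ldots,\lambda_{n,n}\in\mathbb{K}$ such that \[ f(x)=\sum_{j=1}^{n}\lambda_{n,j}\,x^{n-j}a(x^{j})\qquad (x\in\mathbb{F}); \] (iv) if $\kappa=2^{n}$, then there exists a symmetric $n$-additive mapping $A_{n}\colon\mathbb{F}^{n}\to\mathbb{K}$ with $f(x)=A_{n}(x,\ldots,x)$ for all $x\in\mathbb{F}$ and \[ \sum_{\sigma\in\mathscr{S}_{n+1}}\Big\{A_{n}(x_{\sigma(1)}x_{\sigma(2)},x_{\sigma(3)},\ldots,x_{\sigma(n+1)})-x_{\sigma(1)}A_{n}(x_{\sigma(2)},x_{\sigma(3)},\ldots,x_{\sigma(n+1)})-x_{\sigma(2)}A_{n}(x_{\sigma(1)},x_{\sigma(3)},\ldots,x_{\sigma(n+1)})\Big\}=0 \] for all $x_{1},\ldots,x_{n+1}\in\mathbb{F}$, where $\mathscr{S}_{n+1}$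 is the symmetric group on $\{1,\ldots,n+1\}$.
   Context: A map $A\colon\mathbb{F}^{n}\to\mathbb{K}$ is $n$-additive if it is additive (a homomorphism of the additive groups) in each variable separately; it is symmetric if invariant under permutations of its arguments. A generalized monomial of degree $n$ is a function $f\colon\mathbb{F}\to\mathbb{K}$ of the form $f(x)=A(x,\ldots,x)$ for some symmetric $n$-additive $A\colon\mathbb{F}^{n}\to\mathbb{K}$ (such $A$ is uniquely determined by $f$). Derivations of higher order: the identically zero map is the only derivation of order $0$; for $m\ge1$, an additive map $d\colon\mathbb{F}\to\mathbb{K}$ is a derivation of order $m$ if there is a map $B\colon\mathbb{F}\times\mathbb{F}\to\mathbb{K}$ which is a derivation of order $m-1$ in each variable such that $d(xy)-xd(y)-d(x)y=B(x,y)$ for all $x,y\in\mathbb{F}$. *)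

(* Defs.v *)
From HB Require Import structures.
From mathcomp Require Import all_boot all_order all_algebra all_fingroup.
Set Implicit Arguments. Unset Strict Implicit. Unset Printing Implicit Defensive.
Import GRing.Theory.
Local Open Scope ring_scope.

(* Convention: the field extension F ⊂ K is given by a ring morphism
   iota : F -> K (automatically injective since F is a field);
   x ∈ F viewed in K is iota x. *)

Definition upd (F : Type) (n : nat) (v : 'I_n -> F) (i : 'I_n) (u : F) : 'I_n -> F :=
  fun j => if j == i then u else v j.

Definition n_additive (F K : zmodType) (n : nat) (A : ('I_n -> F) -> K) : Prop :=
  forall (v : 'I_n -> F) (i : 'I_n) (u w : F),
    A (upd v i (u + w)) = A (upd v i u) + A (upd v i w).

Definition symmetric_map (F K : Type) (n : nat) (A : ('I_n -> F) -> K) : Prop :=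
  forall (s : 'S_n) (v : 'I_n -> F), A (fun i => v (s i)) = A v.

Definition gen_monomial (F K : zmodType) (n : nat) (f : F -> K) : Prop :=
  exists A : ('I_n -> F) -> K,
    n_additive A /\ symmetric_map A /\ forall x, f x = A (fun _ => x).

Definition additive_map (F K : zmodType) (d : F -> K) : Prop :=
  forall x y, d (x + y) = d x + d y.

Fixpoint higher_derivation (F K : fieldType) (iota : F -> K) (m : nat)
  (d : F -> K) {struct m} : Prop :=
  match m with
  | 0 => forall x, d x = 0
  | m'.+1 =>
      additive_map d /\
      exists B : F -> F -> K,
        (forall y, higher_derivation iota m' (fun x => B x y)) /\
        (forall x, higher_derivation iota m' (B x)) /\
        (forall x y, d (x * y) - iota x * d y - d x * iota y = B x y)
  end.

(* Main.v *)
Require Import Defs.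
From HB Require Import structures.
From mathcomp Require Import all_boot all_order all_algebra all_fingroup.
From mathcomp Require Import zify ring.
From Stdlib Require Import FunctionalExtensionality.
Import GRing.Theory.
Set Implicit Arguments. Unset Strict Implicit. Unset Printing Implicit Defensive.
Local Open Scope ring_scope.

(** Write [f (1 + t x) = \sum_k T_k(x) t^k] for natural numbers [t]. Since
    [(1 + t x)^2 = 1 + t (2 x + t x^2)], the hypothesis becomes
    [\sum_k t^k T_k(2 x + t x^2) = kappa (1 + t x)^n \sum_k T_k(x) t^k], an
    identity between polynomials in [t]. Its coefficient of [t^m] reads
    [(2^m - kappa) T_m = (terms in the T_k with k < m)]. Hence [T_m = 0] as long
    as [kappa] is not a power of two, which gives (i), and (ii) after subtracting
    [f(1) x^n]. For [kappa = 2^n] only [T_n = f] survives and the coefficient of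
    [t^(n+1)] is [A (x^2, x, ..., x) = 2 x A (x, ..., x)], to be polarized.
    For [kappa = 2] every [T_m] is a combination of the [x^(m-j) a(x^j)] with
    [a = T_1]; substituting this expression of [f] into the hypothesis gives a
    nontrivial relation [\sum_l mu_l x^(2n-l) a(x^l) = 0], which forces the
    additive map [a] to be a derivation of order [2n - 1]. *)

(** * Additive and multi-additive maps *)

Section AdditiveMaps.
Variables (F K : zmodType) (d : F -> K).
Hypothesis d_add : additive_map d.

Lemma additive_map0 : d 0 = 0.
Proof. by apply: (addrI (d 0)); rewrite -d_add !addr0. Qed.

Lemma additive_map_sum (I : Type) (r : seq I) (P : pred I) (c : I -> F) :
  d (\sum_(i <- r | P i) c i) = \sum_(i <- r | P i) d (c i).
Proof. by apply: big_morph => //; exact: additive_map0. Qed.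

Lemma additive_mapMn x m : d (x *+ m) = d x *+ m.
Proof.
by elim: m => [|m IH]; rewrite ?mulr0n ?additive_map0 // !mulrS d_add IH.
Qed.

End AdditiveMaps.

Lemma additive_rmorph (F K : pzRingType) (h : {rmorphism F -> K}) :
  additive_map h.
Proof. exact: rmorphD. Qed.

Section MultiAdditive.
Variables (F K : zmodType) (n : nat) (A : ('I_n -> F) -> K).
Hypothesis A_add : n_additive A.

Lemma upd_additive v i : additive_map (fun u => A (upd v i u)).
Proof. by move=> u w; exact: A_add. Qed.

Lemma upd_id (v : 'I_n -> F) i : upd v i (v i) = v.
Proof. by apply: functional_extensionality => j; rewrite /upd; case: eqP => // ->. Qed.

Lemma n_additive_eq0 v i : v i = 0 -> A v = 0.
Proof. by move=> vi; rewrite -(upd_id v i) vi (additive_map0 (upd_additive v i)). Qed.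

(** Slots are expanded one at a time, [r] listing those already done. Pinning [g] to the default
    [j0] off [r] makes each choice of indices on [r] occur exactly once. *)
Lemma n_additive_expand_seq (J : finType) (j0 : J) (c : 'I_n -> J -> F)
    (r : seq 'I_n) : uniq r ->
  A (fun i => \sum_j c i j) =
  \sum_(g : {ffun 'I_n -> J} | [forall i, (i \notin r) ==> (g i == j0)])
     A (fun i => if i \in r then c i (g i) else \sum_j c i j).
Proof.
elim: r => [_|i0 r IH /= /andP[i0r ur]].
  rewrite (big_pred1 [ffun=> j0]) // => g.
  apply/forallP/eqP => [h | -> i]; last by rewrite ffunE eqxx.
  by apply/ffunP => i; rewrite ffunE; apply/eqP; have := h i.
rewrite (IH ur) [RHS](partition_big (fun g : {ffun _} => g i0) predT) //=.
transitivity (\sum_(j : J)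
    \sum_(h : {ffun 'I_n -> J} | [forall i, (i \notin r) ==> (h i == j0)])
    A (upd (fun i => if i \in r then c i (h i) else \sum_j c i j) i0 (c i0 j))).
  rewrite exchange_big; apply: eq_bigr => h _.
  rewrite -(additive_map_sum (upd_additive _ i0)); congr A.
  apply: functional_extensionality => i; rewrite /upd; case: eqP => // ->.
  by rewrite (negPf i0r).
apply: eq_bigr => j _.
pose ins (h : {ffun 'I_n -> J}) := [ffun i => if i == i0 then j else h i].
pose del (h : {ffun 'I_n -> J}) := [ffun i => if i == i0 then j0 else h i].
rewrite [RHS](reindex_onto ins del); last first.
  move=> g /andP[_ /eqP gj]; apply/ffunP => i.
  by rewrite !ffunE; case: eqP => // ->.
apply: eq_big => [h|h _]; last first.
  congr A; apply: functional_extensionality => i; rewrite /upd inE ffunE.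
  by case: eqP => // ->.
rewrite ffunE !eqxx andbT; apply/forallP/andP => [H|[/forallP H /eqP e] i].
  split.
    apply/forallP => i; rewrite inE negb_or ffunE; have := H i.
    by case: (i =P i0).
  apply/eqP/ffunP => i; rewrite !ffunE; case: eqP => // ->.
  by have := H i0; rewrite i0r => /eqP.
apply/implyP => ir; rewrite -e !ffunE; case: (i =P i0) => // /eqP ni.
by have := H i; rewrite inE negb_or ni ir ffunE (negPf ni).
Qed.

Lemma n_additive_expand (J : finType) (j0 : J) (c : 'I_n -> J -> F) :
  A (fun i => \sum_j c i j) =
  \sum_(g : {ffun 'I_n -> J}) A (fun i => c i (g i)).
Proof.
rewrite (n_additive_expand_seq j0 c (enum_uniq 'I_n)).
apply: eq_big => [g|g _].
  by apply/forallP => i; rewrite mem_enum.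
by congr A; apply: functional_extensionality => i; rewrite mem_enum.
Qed.

Lemma n_additive_scale (w : 'I_n -> F) (m : 'I_n -> nat) :
  A (fun i => w i *+ m i) = A w *+ \prod_i m i.
Proof.
have H (r : seq 'I_n) : uniq r ->
    A (fun i => if i \in r then w i *+ m i else w i) = A w *+ \prod_(i <- r) m i.
  elim: r => [_|i0 r IH /= /andP[i0r ur]]; first by rewrite big_nil.
  rewrite big_cons mulnC mulrnA -(IH ur).
  rewrite -[in RHS](upd_id (fun i => if i \in r then _ else _) i0) (negPf i0r).
  rewrite -(additive_mapMn (upd_additive _ i0)); congr A.
  by apply: functional_extensionality => i; rewrite /upd inE; case: eqP => // ->.
have /= := H _ (enum_uniq 'I_n); rewrite big_enum /= => <-.
by congr A; apply: functional_extensionality => i; rewrite mem_enum.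
Qed.

End MultiAdditive.

(** * Restriction of a multi-additive map to a line, as a polynomial *)

Section LinePolynomial.
Variables (F K : fieldType) (n : nat) (A : ('I_n -> F) -> K).
Hypothesis A_add : n_additive A.

Definition weight (S : {ffun 'I_n -> bool}) : nat := \sum_i S i.

(** Represents t -> A (u + t w) for natural t; [S] marks the slots that receive [w], which makes
    every coefficient explicit. *)
Definition line_poly (u w : 'I_n -> F) : {poly K} :=
  \sum_(S : {ffun 'I_n -> bool}) A (fun i => if S i then w i else u i) *: 'X^(weight S).

Lemma line_polyE u w (t : nat) :
  (line_poly u w).[t%:R] = A (fun i => u i + w i *+ t).
Proof.
pose c (i : 'I_n) (b : bool) := if b then w i *+ t else u i.
transitivity (A (fun i => \sum_b c i b)); last first.
  by congr A; apply: functional_extensionality => i; rewrite big_bool addrC.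
rewrite (n_additive_expand A_add false) /line_poly horner_sum.
apply: eq_bigr => S _; rewrite hornerZ hornerXn -natrX mulr_natr.
rewrite /weight expn_sum -(n_additive_scale A_add); congr A.
by apply: functional_extensionality => i; rewrite /c; case: (S i).
Qed.

Lemma coef_line_poly u w k :
  (line_poly u w)`_k =
  \sum_(S : {ffun 'I_n -> bool} | weight S == k) A (fun i => if S i then w i else u i).
Proof.
rewrite coef_sum [RHS]big_mkcond; apply: eq_bigr => S _.
by rewrite coefZ coefXn eq_sym; case: eqP; rewrite ?mulr1 ?mulr0.
Qed.

Lemma weight_le S : (weight S <= n)%N.
Proof.
by rewrite -[n in (_ <= n)%N]card_ord -sum1_card leq_sum // => i _; case: (S i).
Qed.

Lemma weight_eq_max S : weight S = n -> S = [ffun=> true].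
Proof.
move=> Sn; apply/ffunP => i; rewrite ffunE; apply/negbNE/negP => /negPf Si.
suff: (weight S < n)%N by rewrite Sn ltnn.
rewrite -[n in (_ < n)%N]card_ord -sum1_card /weight (bigD1 i) //= [X in (_ < X)%N](bigD1 i) //= Si add0n ltnS.
by apply: leq_sum => j _; case: (S j).
Qed.

Lemma sum_weight1 (V : nmodType) (G : {ffun 'I_n -> bool} -> V) :
  \sum_(S | weight S == 1%N) G S = \sum_i G [ffun j => j == i].
Proof.
have wP S : weight S == 1%N -> exists i, S = [ffun j => j == i].
  case/sum_nat_eq1 => i [_ Si Sj]; exists i; apply/ffunP => j; rewrite ffunE.
  have [->|/Sj/(_ isT)] := eqVneq j i; first by case: (S i) Si.
  by case: (S j).
(* The inverse of [i] -> indicator of [i] picks a true slot and needs a default one, so [n = 0] is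
   treated apart. *)
have [n0|n0] := posnP n.
  have no (i : 'I_n) : False by case: i => i; rewrite n0.
  rewrite big_pred0 => [|S]; last by apply/negP => /wP[i]; case: (no i).
  by rewrite big1 // => i; case: (no i).
rewrite (reindex_onto (fun i => [ffun j => j == i])
   (fun S => odflt (Ordinal n0) [pick i | S i])) /=; last first.
  move=> S /wP[i ->]; apply/ffunP => j; rewrite !ffunE.
  case: pickP => [k|/(_ i)]; rewrite ffunE ?eqxx // => /eqP -> //.
apply: eq_bigl => i; apply/andP; split.
  apply/sum_nat_eq1; exists i; split => //; first by rewrite ffunE eqxx.
  by move=> j ji _; rewrite ffunE (negPf ji).
case: pickP => [k|/(_ i)]; rewrite ffunE ?eqxx // => /eqP -> //.
Qed.

Lemma size_line_poly u w : (size (line_poly u w) <= n.+1)%N.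
Proof.
apply/leq_sizeP => k nk; rewrite coef_line_poly big_pred0 // => S.
by apply/negP => /eqP Sk; have := weight_le S; rewrite Sk leqNgt nk.
Qed.

Lemma coef1_line_poly u w :
  (line_poly u w)`_1 = \sum_i A (upd u i (w i)).
Proof.
rewrite coef_line_poly sum_weight1; apply: eq_bigr => i _; congr A.
by apply: functional_extensionality => j; rewrite ffunE /upd; case: eqP => // ->.
Qed.

End LinePolynomial.

(** * Polynomial identities in characteristic zero *)

Section CharZero.
Variable K : fieldType.
Hypothesis charK : [pchar K] =i pred0.

Lemma natr_eq0_char0 m : (m%:R == 0 :> K) = (m == 0)%N.
Proof. exact: (pcharf0P K).1. Qed.

Lemma natr_inj_char0 : injective (fun m : nat => m%:R : K).
Proof.
suff H m p : (m <= p)%N -> m%:R = p%:R :> K -> m = p.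
  by move=> m p /= e; case/orP: (leq_total m p) => /H; [exact|move=> <-].
move=> mp /eqP; rewrite eq_sym -subr_eq0 -natrB // natr_eq0_char0 subn_eq0 => pm.
by apply/eqP; rewrite eqn_leq mp.
Qed.

(** A nonzero difference would have too many roots. Additive maps respect natural multiples, so
    identities are available at natural t; this turns them into identities of coefficients. *)
Lemma poly_eq_on_nat (p q : {poly K}) :
  (forall t : nat, p.[t%:R] = q.[t%:R]) -> p = q.
Proof.
move=> pq; apply/eqP; rewrite -subr_eq0; apply/negbNE/negP => r0.
have := max_poly_roots (rs := [seq m%:R | m <- iota 0 (size (p - q))]) r0.
rewrite size_map size_iota ltnn map_inj_uniq ?iota_uniq; last exact: natr_inj_char0.
move=> H; suff: false by []; apply: H => //.
by apply/allP => _ /mapP[t _ ->]; rewrite rootE hornerD hornerN pq subrr.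
Qed.

Lemma expr2_inj_char0 k m : (2 ^+ k == 2 ^+ m :> K) = (k == m).
Proof.
rewrite -!natrX (inj_eq natr_inj_char0); apply/eqP/eqP => [|->] //.
by move/eqP; rewrite eqn_exp2l // => /eqP.
Qed.

End CharZero.

(* Polarization: in the alternating sum of [H] at the points
   [\sum_(j in T) x j], only the surjective index functions survive. *)
Lemma sum_perm_eq0 (F : zmodType) (K : pzRingType) (N : nat) (H : ('I_N -> F) -> K) :
  n_additive H -> (forall y, H (fun=> y) = 0) ->
  forall x, \sum_(s : 'S_N) H (fun i => x (s i)) = 0.
Proof.
move=> H_add H0 x.
have [N0|N0] := posnP N.
  by subst N; rewrite big1 // => s _; rewrite -(H0 0); congr H;
     apply: functional_extensionality => - [].
pose j0 := Ordinal N0.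
have E : \sum_(g : {ffun 'I_N -> 'I_N}) \sum_(T : {set 'I_N} | [forall i, g i \in T])
    (-1) ^+ #|T| * H (fun i => x (g i)) = 0.
  transitivity (\sum_(T : {set 'I_N}) (-1) ^+ #|T| * H (fun=> \sum_(j in T) x j));
    last by rewrite big1 // => T _; rewrite H0 mulr0.
  under eq_bigr do rewrite big_mkcond.
  rewrite exchange_big; apply: eq_bigr => T _ /=.
  transitivity ((-1) ^+ #|T| * H (fun=> \sum_j if j \in T then x j else 0)); last first.
    by congr (_ * H _); apply: functional_extensionality => i; rewrite -big_mkcond.
  rewrite (n_additive_expand H_add j0 (fun _ j => if j \in T then x j else 0)).
  rewrite mulr_sumr; apply: eq_bigr => g _.
  case: ifP => [/forallP gT|/negbT]; last rewrite negb_forall.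
    by congr (_ * H _); apply: functional_extensionality => i; rewrite gT.
  by case/existsP => i /negPf gi; rewrite (n_additive_eq0 H_add (i := i)) ?gi ?mulr0.
have sumT (g : {ffun 'I_N -> 'I_N}) : ~~ injectiveb g ->
    \sum_(T : {set 'I_N} | [forall i, g i \in T]) (-1) ^+ #|T| = 0 :> K.
  move=> ginj.
  have [j gj] : exists j, forall i, g i != j.
    have [/existsP[j /forallP]|] := boolP [exists j, forall i, g i != j]; first by exists j.
    rewrite negb_exists => /forallP surj; case/negP: ginj.
    apply/card_uniqP; rewrite size_codom; apply: eq_card => j; rewrite inE.
    have := surj j; rewrite negb_forall => /existsP[i]; rewrite negbK => /eqP <-.
    exact: codom_f.
  (* Adding or removing the missed value [j] pairs the sets [T] with opposite signs. *)
  rewrite (bigID (fun T : {set 'I_N} => j \in T)) /=.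
  rewrite (reindex_onto (fun T => j |: T) (fun T => T :\ j)); last first.
    by move=> T /andP[_ jT]; rewrite setD1K.
  apply/eqP; rewrite addr_eq0 -sumrN; apply/eqP; apply: eq_big => [T|T].
    rewrite setU11 andbT; apply/andP/andP => [[/forallP h /eqP e]|[/forallP h jT]].
      split; last by rewrite -e !inE eqxx.
      by apply/forallP => i; have := h i; rewrite !inE (negPf (gj i)).
    by split; [apply/forallP => i; rewrite !inE h orbT | rewrite setU1K].
  case/andP=> _ /eqP e; have jT : j \notin T by rewrite -e !inE eqxx.
  by rewrite cardsU1 jT exprS mulN1r.
have sumI (g : {ffun 'I_N -> 'I_N}) : injectiveb g ->
    \sum_(T : {set 'I_N} | [forall i, g i \in T]) (-1) ^+ #|T| = (-1) ^+ N :> K.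
  (* An injective [g] is onto, so only the full set contains its image. *)
  move=> /injectiveP ginj; rewrite (big_pred1 setT) ?cardsT ?card_ord // => T.
  apply/forallP/eqP => [gT|-> i]; last by rewrite inE.
  apply/setP => j; rewrite inE; have [g' _ gK] := injF_bij ginj.
  by rewrite -(gK j) gT.
move: E; rewrite (bigID (fun g : {ffun _} => injectiveb g)) /= [X in _ + X]big1 ?addr0; last first.
  by move=> g /sumT; rewrite -mulr_suml => ->; rewrite mul0r.
under eq_bigr => g /sumI e do rewrite -mulr_suml e.
rewrite -mulr_sumr => /(congr1 ( *%R ((-1) ^+ N))); rewrite mulr0 signrMK => E.
rewrite -[RHS]E [RHS](reindex_onto (@pval _) (insubd (1%g : 'S_N))) /=; last first.
  by move=> g gi; rewrite insubdK.
apply: eq_big => [s|s _]; first by rewrite (valP s) valKd eqxx.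
by congr H; apply: functional_extensionality => i; rewrite pvalE.
Qed.

(** * The recurrence for the coefficients T_k *)

Section SquareEquation.
Variables (F K : fieldType) (iota : {rmorphism F -> K}).
Hypothesis charK : [pchar K] =i pred0.
Variables (n : nat) (A : ('I_n -> F) -> K).
Hypothesis A_add : n_additive A.

Definition taylor k x := (line_poly A (fun=> 1) (fun=> x))`_k.

Lemma taylorE k x : taylor k x =
  \sum_(S : {ffun 'I_n -> bool} | weight S == k) A (fun i => if S i then x else 1).
Proof. exact: coef_line_poly. Qed.

Lemma taylor_sum x t :
  A (fun=> 1 + x *+ t) = \sum_(k < n.+1) taylor k x * t%:R ^+ k.
Proof.
by rewrite -(line_polyE A_add) (horner_coef_wide _ (size_line_poly _ _ _)).
Qed.

Lemma taylor0 x : taylor 0 x = A (fun=> 1).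
Proof.
rewrite /taylor -horner_coef0 -[0]/(0%:R) (line_polyE A_add).
by congr A; apply: functional_extensionality => i; rewrite mulr0n addr0.
Qed.

Lemma taylor_max x : taylor n x = A (fun=> x).
Proof.
rewrite taylorE (big_pred1 [ffun=> true]).
  by congr A; apply: functional_extensionality => i; rewrite ffunE.
move=> S; apply/eqP/eqP => [/weight_eq_max //|->].
by rewrite /weight; under eq_bigr do rewrite ffunE; rewrite sum1_card card_ord.
Qed.

Lemma taylor1_additive : additive_map (taylor 1).
Proof.
move=> x y; rewrite /taylor !coef1_line_poly -big_split; apply: eq_bigr => i _.
exact: A_add.
Qed.

Lemma taylorMn k x c : taylor k (x *+ c) = c%:R ^+ k * taylor k x.
Proof.
rewrite !taylorE mulr_sumr; apply: eq_bigr => S /eqP Sk.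
rewrite -natrX mulr_natl -Sk /weight expn_sum -(n_additive_scale A_add); congr A.
by apply: functional_extensionality => i; case: (S i).
Qed.

(** Represents T_k(2x + t x^2) as a polynomial in t: slots in [S] start at 2x and move along x^2,
    while slots holding 1 do not move. *)
Definition taylor_sq k x : {poly K} :=
  \sum_(S : {ffun 'I_n -> bool} | weight S == k)
    line_poly A (fun i => if S i then x *+ 2 else 1)
                (fun i => if S i then x ^+ 2 else 0).

Lemma taylor_sqE k x t :
  (taylor_sq k x).[t%:R] = taylor k (x *+ 2 + x ^+ 2 *+ t).
Proof.
rewrite taylorE horner_sum; apply: eq_bigr => S _.
rewrite (line_polyE A_add); congr A; apply: functional_extensionality => i.
by case: (S i); rewrite ?mul0rn ?addr0.
Qed.

Lemma taylor_sq_coef0 k x : (taylor_sq k x)`_0 = 2 ^+ k * taylor k x.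
Proof. by rewrite -horner_coef0 -[0]/(0%:R) taylor_sqE mulr0n addr0 taylorMn. Qed.

Lemma taylor_sq_eq0 k x : (forall y, taylor k y = 0) -> taylor_sq k x = 0.
Proof. by move=> Tk; apply: (poly_eq_on_nat charK) => t; rewrite taylor_sqE Tk horner0. Qed.

Definition expo_poly (x : F) : {poly K} :=
  \poly_(i < n.+1) (iota x ^+ i * 'C(n, i)%:R).

Lemma expo_polyE x (t : nat) : (expo_poly x).[t%:R] = iota (1 + x *+ t) ^+ n.
Proof.
rewrite horner_poly rmorphD rmorph1 rmorphMn exprDn; apply: eq_bigr => i _.
by rewrite -natrX expr1n mul1r exprMn_n !mulr_natr mulrnAC.
Qed.

Lemma coef_expo_poly x i : (expo_poly x)`_i = iota x ^+ i * 'C(n, i)%:R.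
Proof. by rewrite coef_poly; case: ltnP => // ni; rewrite bin_small // mulr0. Qed.

Variable kappa : K.
Hypothesis sqA : forall x : F,
  A (fun=> x ^+ 2) = kappa * iota x ^+ n * A (fun=> x).

Lemma taylor_poly_eq x :
  \sum_(k < n.+1) 'X^k * taylor_sq k x =
  kappa *: (expo_poly x * line_poly A (fun=> 1) (fun=> x)).
Proof.
apply: (poly_eq_on_nat charK) => t.
rewrite hornerZ hornerM expo_polyE (line_polyE A_add) mulrA -sqA horner_sum.
have -> : (1 + x *+ t) ^+ 2 = 1 + (x *+ 2 + x ^+ 2 *+ t) *+ t.
  by ring.
rewrite taylor_sum; apply: eq_bigr => k _.
by rewrite hornerM hornerXn taylor_sqE mulrC.
Qed.

(** The factor t^k removes the terms with k > m. No bound [m <= n] is imposed: m = n + 1 gives the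
    coefficient used when kappa = 2^n. *)
Lemma taylor_coef_eq m x :
  \sum_(k < n.+1 | (k <= m)%N) (taylor_sq k x)`_(m - k) =
  kappa * \sum_(i < m.+1) iota x ^+ i * 'C(n, i)%:R * taylor (m - i) x.
Proof.
have /(congr1 (fun p : {poly K} => p`_m)) := taylor_poly_eq x.
rewrite coefZ coefM coef_sum; under [X in _ = _ * X]eq_bigr do rewrite coef_expo_poly.
move=> <-; rewrite big_mkcond; apply: eq_bigr => k _.
by rewrite coefXnM ltnNge; case: leqP.
Qed.

(** The index k = m contributes 2^m T_m on the left and i = 0 contributes kappa T_m on the right;
    all other terms involve only lower T_k. *)
Lemma taylor_coef_eq_le m x : (m <= n)%N ->
  (2 ^+ m - kappa) * taylor m x =
  kappa * (\sum_(i < m) iota x ^+ i.+1 * 'C(n, i.+1)%:R * taylor (m - i.+1) x)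
  - \sum_(k < m) (taylor_sq k x)`_(m - k).
Proof.
move=> mn; have := taylor_coef_eq m x.
have -> : \sum_(k < n.+1 | (k <= m)%N) (taylor_sq k x)`_(m - k) =
          \sum_(k < m.+1) (taylor_sq k x)`_(m - k).
  exact/esym/(big_ord_widen n.+1 (fun k => (taylor_sq k x)`_(m - k))).
rewrite big_ord_recr /= subnn taylor_sq_coef0 => /(canRL (addKr _)) e.
rewrite mulrBl e big_ord_recl /= expr0 bin0 !mul1r subn0.
set R := \sum_(i < m) iota x ^+ _ * _ * _; set S := \sum_(i < m) _`_ _.
by rewrite -/R; ring.
Qed.

(** Strong induction: once the lower maps vanish, (2^m - kappa) T_m = 0. The exceptional [k] are
    left to the hypothesis, and [M] allows stopping early: at n for kappa = 2^n, at 1 for kappa =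
    2. *)
Lemma taylor_vanish M : (M <= n.+1)%N ->
  (forall k, (k < M)%N -> kappa = 2 ^+ k -> forall x, taylor k x = 0) ->
  forall k, (k < M)%N -> forall x, taylor k x = 0.
Proof.
move=> Mn T0; elim/ltn_ind => m IH mM x.
have [km|km] := eqVneq kappa (2 ^+ m); first exact: T0.
have := taylor_coef_eq_le x (leq_trans mM Mn : (m <= n)%N).
rewrite !big1 ?mulr0 ?subr0.
- by move/eqP; rewrite mulf_eq0 subr_eq0 eq_sym (negPf km) => /eqP.
- by move=> k _; rewrite taylor_sq_eq0 ?coef0 // => y; apply: IH => //; exact: ltn_trans mM.
- move=> k _; rewrite IH ?mulr0 ?rev_ord_proof //.
  by apply: leq_ltn_trans mM; rewrite leq_subr.
Qed.

Lemma diagonal_vanish :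
  (forall k, (k <= n)%N -> kappa = 2 ^+ k -> forall x, taylor k x = 0) ->
  forall x, A (fun=> x) = 0.
Proof. by move=> T0 x; rewrite -taylor_max; apply: (@taylor_vanish n.+1). Qed.

Hypothesis A_sym : symmetric_map A.

Lemma A_upd_const (x y : F) i j : A (upd (fun=> x) i y) = A (upd (fun=> x) j y).
Proof.
rewrite -(A_sym (tperm i j) (upd (fun=> x) j y)); congr A.
apply: functional_extensionality => k; rewrite /upd.
by rewrite -[X in _ = if _ == X then _ else _](tpermL i j) (inj_eq perm_inj).
Qed.

Lemma diagonal_leibniz : kappa = 2 ^+ n -> forall (x : F) i,
  A (upd (fun=> x) i (x ^+ 2)) = 2 * iota x * A (fun=> x).
Proof.
move=> kn x i.
have T0 : forall k, (k < n)%N -> forall y, taylor k y = 0.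
  apply: taylor_vanish => // k kn'; rewrite kn => /eqP.
  by rewrite (expr2_inj_char0 charK) => /eqP nk; move: kn'; rewrite nk ltnn.
have n0 : (0 < n)%N by case: i => i; exact: leq_trans.
have /eqP := taylor_coef_eq n.+1 x.
(* On the left only k = n survives, as T_k = 0 for k < n. *)
rewrite (bigD1 ord_max) ?leqnSn //= big1 ?addr0; last first.
  move=> k /andP[_]; rewrite -val_eqE /= => kn'.
  rewrite taylor_sq_eq0 ?coef0 // => y; apply: T0; have := ltn_ord k; lia.
(* On the right only i = 0 and i = 1 are kept, carrying T_(n+1) and T_n; the former vanishes because
   no set of slots has weight n + 1. *)
rewrite big_ord_recl (bigD1 (ord0 : 'I_n.+1)) //= big1 ?addr0; last first.
  move=> k; rewrite -val_eqE /= => k0; rewrite T0 ?mulr0 // /bump /=; have := ltn_ord k; lia.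
rewrite subn0 subSnn /bump /= addn0 subSS subn0 bin1 taylor_max expr1.
have -> : taylor n.+1 x = 0.
  rewrite taylorE big_pred0 // => S; apply/eqP => e.
  by have := weight_le S; rewrite e ltnn.
rewrite mulr0 add0r kn.
(* The derivative at t = 0 of A (2x + t x^2, ...): one of the n slots receives x^2, and each of the
   other n - 1 yields a factor 2. *)
have -> : (taylor_sq n x)`_1 = n%:R * (2 ^+ n.-1 * A (upd (fun=> x) i (x ^+ 2))).
  rewrite /taylor_sq (big_pred1 [ffun=> true]); last first.
    move=> S; apply/eqP/eqP => [/weight_eq_max //|->].
    by rewrite /weight; under eq_bigr do rewrite ffunE; rewrite sum1_card card_ord.
  rewrite coef1_line_poly mulr_natl -[X in _ = _ *+ X](card_ord n) -sumr_const.
  apply: eq_bigr => j _; rewrite (A_upd_const _ _ i j) -natrX mulr_natl.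
  have -> : (2 ^ n.-1 = \prod_(k < n) if k == j then 1 else 2)%N.
    rewrite (bigD1 j) //= eqxx mul1n.
    under eq_bigr => k /negPf kj do rewrite kj.
    by rewrite prod_nat_const cardC1 card_ord.
  rewrite -(n_additive_scale A_add); congr A.
  by apply: functional_extensionality => k; rewrite /upd !ffunE; case: eqP.
have -> : 2 ^+ n = 2 * 2 ^+ n.-1 :> K by rewrite -exprS prednK.
set Z := A _; set Y := A _ => /eqP e.
apply: (@mulfI _ (n%:R * 2 ^+ n.-1)).
  by rewrite mulf_neq0 ?expf_neq0 // (natr_eq0_char0 charK) // -lt0n.
by rewrite -mulrA e; ring.
Qed.

End SquareEquation.

(** * Derivations of higher order through iterated commutators *)

Section HigherDerivations.
Variables (F K : fieldType) (iota : {rmorphism F -> K}).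
Hypothesis charK : [pchar K] =i pred0.
Implicit Types (a b d : F -> K).

Lemma higher_derivationS m d :
  higher_derivation iota m d -> higher_derivation iota m.+1 d.
Proof.
elim: m d => [|m IH] d.
  move=> d0; split=> [x y|]; first by rewrite !d0 addr0.
  exists (fun _ _ => 0); split=> [y x|] //; split=> [x y|x y] //.
  by rewrite !d0 mulr0 mul0r !subr0.
move=> [d_add [B [B1 [B2 dB]]]]; split=> //; exists B; split=> [y|]; first exact/IH/B1.
by split=> // x; exact/IH/B2.
Qed.

Lemma higher_derivation_leq m p d : (m <= p)%N ->
  higher_derivation iota m d -> higher_derivation iota p d.
Proof.
by move=> /subnK <-; elim: (p - m)%N => // q IH /IH; rewrite addSn; exact: higher_derivationS.
Qed.

(** The commutator D_x of [b] with multiplication by [x]; its iterates measure the order of [b] as a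
    differential operator. *)
Definition dshift (x : F) b : F -> K := fun y => b (x * y) - iota x * b y.

Lemma dshift_additive x b : additive_map b -> additive_map (dshift x b).
Proof. by move=> b_add y z; rewrite /dshift mulrDr !b_add; ring. Qed.

Lemma iter_dshift_additive k x b :
  additive_map b -> additive_map (iter k (dshift x) b).
Proof. by move=> b_add; elim: k => //= k IH; exact: dshift_additive. Qed.

Lemma dshiftC x y b : dshift x (dshift y b) = dshift y (dshift x b).
Proof.
by apply: functional_extensionality => z; rewrite /dshift (mulrCA y); ring.
Qed.

Lemma dshift_addl x y b (t : nat) z : additive_map b ->
  dshift (x + y *+ t) b z = dshift x b z + t%:R * dshift y b z.
Proof.
move=> b_add; have e : (x + y *+ t) * z = x * z + (y * z) *+ t by ring.
rewrite /dshift e b_add (additive_mapMn b_add).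
by rewrite rmorphD rmorphMn /=; ring.
Qed.

(** Expands (D_x + t D_y)^k a in powers of t. It is function-valued because the recursion evaluates
    at [x * z] and [y * z]. *)
Fixpoint dshift_poly x y a k : F -> {poly K} :=
  if k is k'.+1 then fun z =>
    dshift_poly x y a k' (x * z) - iota x *: dshift_poly x y a k' z +
    'X * (dshift_poly x y a k' (y * z) - iota y *: dshift_poly x y a k' z)
  else fun z => (a z)%:P.

Lemma dshift_polyE x y a k (t : nat) z : additive_map a ->
  (dshift_poly x y a k z).[t%:R] = iter k (dshift (x + y *+ t)) a z.
Proof.
move=> a_add; elim: k z => [|k IH] z /=; first by rewrite hornerC.
rewrite dshift_addl; last exact: iter_dshift_additive.
by rewrite hornerD hornerM hornerX !(hornerD, hornerN, hornerZ) !IH.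
Qed.

Lemma dshift_poly_coef0 x y a k z :
  (dshift_poly x y a k z)`_0 = iter k (dshift x) a z.
Proof.
elim: k z => [|k IH] z /=; first by rewrite coefC.
by rewrite coefD coefXM addr0 coefB coefZ !IH.
Qed.

(** Since D_x and D_y commute, the linear coefficient of (D_x + t D_y)^(k+1) is (k+1) D_x^k D_y. *)
Lemma dshift_poly_coef1 x y a k z :
  (dshift_poly x y a k.+1 z)`_1 = k.+1%:R * iter k (dshift x) (dshift y a) z.
Proof.
have comm j b : dshift y (iter j (dshift x) b) = iter j (dshift x) (dshift y b).
  by elim: j => //= j IH; rewrite dshiftC IH.
have step j w : (dshift_poly x y a j.+1 w)`_1 =
    dshift x (fun z => (dshift_poly x y a j z)`_1) w +
    dshift y (iter j (dshift x) a) w.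
  by rewrite /= coefD coefXM /= /dshift !(coefB, coefZ) !dshift_poly_coef0.
elim: k z => [|k IH] z.
  by rewrite step /dshift /= !coefC /= mulr0 subr0 add0r mul1r.
rewrite step comm iterS (functional_extensionality _ _ IH).
set D := iter k _ _; rewrite /dshift.
by rewrite -[k.+2]addn1 natrD; ring.
Qed.

(** Induction on [k]: the linear part in t of the hypothesis at x + t y gives D_x^(k+1) D_y a (1) =
    0, so the Leibniz defect of [a] meets the hypotheses for [k] in its first variable; symmetry
    handles the second. *)
Lemma higher_derivation_dshift k a : additive_map a -> a 1 = 0 ->
  (forall x, iter k.+1 (dshift x) a 1 = 0) -> higher_derivation iota k a.
Proof.
elim: k a => [|k IH] a a_add a1 Da.
  by move=> x; have := Da x; rewrite /= /dshift a1 mulr1 mulr0 subr0.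
have Dxy x y : iter k.+1 (dshift x) (dshift y a) 1 = 0.
  have p0 : dshift_poly x y a k.+2 1 = 0.
    by apply: (poly_eq_on_nat charK) => t; rewrite dshift_polyE // Da horner0.
  have /eqP := dshift_poly_coef1 x y a k.+1 1.
  by rewrite p0 coef0 eq_sym mulf_eq0 (natr_eq0_char0 charK) => /eqP.
(* The correction makes [B] vanish at x = 1; as a(1) = 0, [B x y] is a(xy) - x a(y) - a(x) y. *)
pose B x y := dshift y a x - iota x * dshift y a 1.
have BC x y : B x y = B y x.
  by rewrite /B /dshift a1 !mulr1 (mulrC y x); ring.
have HB y : higher_derivation iota k (fun x => B x y).
  apply: IH => [x z|| x].
  - by rewrite /B rmorphD (dshift_additive y a_add) mulrDl; ring.
  - by rewrite /B rmorph1 mul1r subrr.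
  (* D_x annihilates multiples of [iota], so the correction term of [B] disappears at the first
     application. *)
  - rewrite -[RHS](Dxy x y) !iterSr; congr (iter k _ _ 1).
    by apply: functional_extensionality => z; rewrite /B /dshift rmorphM; ring.
split=> //; exists B; do ![split => //] => [x|x y].
  by have -> : B x = B^~ x by apply: functional_extensionality => y; exact: BC.
by rewrite /B /dshift a1 !mulr1 (mulrC y x); ring.
Qed.

(** Multiplying the argument by x is the operator D_x + x, whose summands commute: this is the
    binomial theorem. The common bound [N] makes the range independent of [l]; surplus binomials are
    zero. *)
Lemma pow_dshift N l a x y : (l <= N)%N ->
  a (x ^+ l * y) =
  \sum_(k < N.+1) 'C(l, k)%:R * iota x ^+ (l - k) * iter k (dshift x) a y.
Proof.
elim: l y => [|l IH] y lN.
  by rewrite big_ord_recl /= !mul1r big1 ?addr0 // => k _; rewrite bin_small // !mul0r.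
rewrite exprSr -mulrA IH; last exact: ltnW.
pose e k := iter k (dshift x) a y.
have eS k : iter k (dshift x) a (x * y) = e k.+1 + iota x * e k.
  by rewrite /e /= {2}/dshift subrK.
transitivity (\sum_(k < N) 'C(l, k)%:R * iota x ^+ (l - k) * e k.+1 +
  \sum_(k < N.+1) 'C(l, k)%:R * iota x ^+ (l - k) * (iota x * e k)).
  under eq_bigr do rewrite eS mulrDr.
  by rewrite big_split big_ord_recr /= (bin_small lN) !mul0r addr0.
rewrite big_ord_recl [RHS]big_ord_recl /= !bin0 !subn0 !mul1r addrCA mulrA -exprSr.
congr (_ + _); rewrite -big_split; apply: eq_bigr => k _ /=.
rewrite /bump /= add0n add1n binS natrD subSS -[dshift x _ y]/(e k.+1).
have [kl|lk] := ltnP k l; last by rewrite (bin_small (_ : l < k.+1)%N) //; ring.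
by rewrite -[(l - k)%N](subnSK kl) exprSr; ring.
Qed.

(** D_1 = 0 and D is additive in its subscript, so D_(1+tx) = t D_x. *)
Lemma iter_dshift_scale a k x (t : nat) z : additive_map a ->
  iter k (dshift (1 + x *+ t)) a z = t%:R ^+ k * iter k (dshift x) a z.
Proof.
move=> a_add; elim: k z => [|k IH] z /=; first by rewrite mul1r.
rewrite dshift_addl; last exact: iter_dshift_additive.
by rewrite /dshift !IH rmorph1 !mul1r subrr exprS; ring.
Qed.

(* Rewritten in the powers of [dshift x] at [1], the relation is evaluated at
   [1 + t x]: the term of lowest order in [t] must vanish on its own. *)
Lemma higher_derivation_of_relation a N (mu : nat -> K) :
  additive_map a -> a 1 = 0 ->
  (forall x, \sum_(l < N.+1) mu l * iota x ^+ (N - l) * a (x ^+ l) = 0) ->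
  (exists2 l, (0 < l <= N)%N & mu l != 0) ->
  higher_derivation iota (N - 1) a.
Proof.
move=> a_add a1 rel mu_neq0.
pose E k x := iter k (dshift x) a 1.
pose d k := \sum_(l < N.+1) mu l * 'C(l, k)%:R.
have relE x : \sum_(k < N.+1) d k * iota x ^+ (N - k) * E k x = 0.
  rewrite -[RHS](rel x) /d.
  under eq_bigr do rewrite !mulr_suml.
  rewrite exchange_big; apply: eq_bigr => l _ /=.
  rewrite -[x ^+ l]mulr1 (@pow_dshift N) ?mulr_sumr -1?ltnS //.
  apply: eq_bigr => k _; rewrite -/(E k x).
  have [kl|lk] := leqP k l; last by rewrite bin_small // !(mulr0, mul0r).
  have -> : (N - k = (N - l) + (l - k))%N by have := ltn_ord l; lia.
  by rewrite exprD; ring.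
have [k0 /andP[/andP[k0_gt0 k0N] dk0] k0_min] :
    exists2 k0, (0 < k0 <= N)%N && (d k0 != 0) &
      forall k, (0 < k)%N -> (k < k0)%N -> d k = 0.
  (* The passage from [mu] to [d] is triangular with unit diagonal: at the largest L with mu_L
     nonzero, d_L = mu_L. *)
  have exd : exists k, (0 < k <= N)%N && (d k != 0).
    have exmu : exists l, (0 < l <= N)%N && (mu l != 0).
      by case: mu_neq0 => l l1 l2; exists l; rewrite l1.
    have bnd l : (0 < l <= N)%N && (mu l != 0) -> (l <= N)%N by case/andP=> /andP[].
    case: (ex_maxnP exmu bnd) => L /andP[/andP[L1 L2] muL] Lmax.
    exists L; rewrite L1 L2 /= /d (bigD1 (Ordinal (L2 : (L < N.+1)%N))) //= binn mulr1.
    rewrite big1 ?addr0 // => l; rewrite -val_eqE /= => lL.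
    have [lltL|Lltl|e] := ltngtP l L; last by rewrite e eqxx in lL.
      by rewrite bin_small // mulr0.
    have [->|mul] := eqVneq (mu l) 0; first by rewrite mul0r.
    have := Lmax l; rewrite mul (leq_trans _ Lltl) //= -ltnS ltn_ord /= => /(_ isT).
    by rewrite leqNgt Lltl.
  case: (ex_minnP exd) => k0 Pk0 k0_min; exists k0 => // k kgt0 kk0.
  apply/eqP/negbNE/negP => dk; case/andP: Pk0 => /andP[_ k0N] _.
  have := k0_min k; rewrite dk kgt0 (leq_trans (ltnW kk0) k0N) => /(_ isT).
  by rewrite leqNgt kk0.
have Ek0 x : E k0 x = 0.
  pose p := \sum_(k < N.+1) (d k * E k x) *: ((1 + iota x *: 'X) ^+ (N - k) * 'X^k).
  have p0 : p = 0.
    apply: (poly_eq_on_nat charK) => t; rewrite horner0 -[RHS](relE (1 + x *+ t)).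
    rewrite horner_sum; apply: eq_bigr => k _; rewrite hornerZ hornerM hornerXn.
    rewrite horner_exp hornerD hornerZ hornerX hornerC.
    rewrite /E iter_dshift_scale // rmorphD rmorph1 rmorphMn /= -(mulr_natr (iota x) t).
    by ring.
  have := congr1 (fun q : {poly K} => q`_k0) p0.
  rewrite coef0 coef_sum (bigD1 (Ordinal (k0N : (k0 < N.+1)%N))) //= big1; last first.
    (* Terms with k > k0 carry a higher power of t. Below k0, the term k = 0 vanishes because a(1) =
       0, the others by minimality of k0. *)
    move=> k; rewrite -val_eqE /= coefZ coefMXn => kk0.
    have [klt|klt|e] := ltngtP k k0; [|by rewrite mulr0|by rewrite e eqxx in kk0].
    have [k_eq0|k_gt0] := posnP k; first by rewrite k_eq0 /E /= a1 mulr0 mul0r.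
    by rewrite k0_min // !mul0r.
  rewrite addr0 coefZ coefMXn ltnn subnn -horner_coef0 horner_exp hornerD hornerZ.
  rewrite hornerX hornerC mulr0 addr0 expr1n mulr1 => /eqP.
  by rewrite mulf_eq0 (negPf dk0) => /eqP.
apply: (@higher_derivation_leq k0.-1); first lia.
by apply: higher_derivation_dshift => // x; rewrite prednK //; exact: Ek0.
Qed.

End HigherDerivations.

(** * Combinations of the functions x^(m-j) a(x^j) *)

Section MonomialSpan.
Variables (F K : fieldType) (iota : {rmorphism F -> K}).
Hypothesis charK : [pchar K] =i pred0.
Variable a : F -> K.
Hypothesis a_add : additive_map a.

(** The coefficients are uniform in x, and the powers inside [a] start at 1. *)
Definition pow_span m (g : F -> K) := exists lam : nat -> K, forall x,
  g x = \sum_(l < m) lam l * iota x ^+ (m - l.+1) * a (x ^+ l.+1).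

Lemma pow_span_ext m g h : g =1 h -> pow_span m g -> pow_span m h.
Proof. by move=> gh [lam H]; exists lam => x; rewrite -gh. Qed.

Lemma pow_span0 m : pow_span m (fun=> 0).
Proof. by exists (fun=> 0) => x; rewrite big1 // => l _; rewrite !mul0r. Qed.

Lemma pow_spanD m g h :
  pow_span m g -> pow_span m h -> pow_span m (fun x => g x + h x).
Proof.
move=> [lam G] [mu H]; exists (fun l => lam l + mu l) => x.
by rewrite G H -big_split; apply: eq_bigr => l _ /=; rewrite !mulrDl.
Qed.

Lemma pow_spanZ m c g : pow_span m g -> pow_span m (fun x => c * g x).
Proof.
move=> [lam G]; exists (fun l => c * lam l) => x.
by rewrite G mulr_sumr; apply: eq_bigr => l _; rewrite !mulrA.
Qed.

Lemma pow_span_sum m (I : Type) (r : seq I) (P : pred I) (g : I -> F -> K) :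
  (forall i, P i -> pow_span m (g i)) ->
  pow_span m (fun x => \sum_(i <- r | P i) g i x).
Proof.
move=> H; elim: r => [|i r IH].
  by apply: pow_span_ext (pow_span0 m) => x; rewrite big_nil.
have [Pi|Pi] := boolP (P i); last first.
  by apply: pow_span_ext IH => x; rewrite big_cons (negPf Pi).
by apply: pow_span_ext (pow_spanD (H i Pi) IH) => x; rewrite big_cons Pi.
Qed.

Lemma pow_span_pow m r l : (0 < l)%N -> m = (r + l)%N ->
  pow_span m (fun x => iota x ^+ r * a (x ^+ l)).
Proof.
move=> l0 ->; have ll : (l.-1 < r + l)%N by lia.
exists (fun j => (j == l.-1)%:R) => x.
rewrite (bigD1 (Ordinal ll)) //= eqxx mul1r prednK // addnK big1 ?addr0 //.
by move=> j; rewrite -val_eqE /= => /negPf ->; rewrite !mul0r.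
Qed.

Lemma pow_spanM m r g :
  pow_span m g -> pow_span (m + r) (fun x => iota x ^+ r * g x).
Proof.
move=> [lam G].
apply: (@pow_span_ext _ (fun x =>
    \sum_(l < m) lam l * (iota x ^+ (r + (m - l.+1)) * a (x ^+ l.+1)))) => [x|].
  by rewrite G mulr_sumr; apply: eq_bigr => l _; rewrite exprD; ring.
apply: pow_span_sum => l _; apply/pow_spanZ/pow_span_pow => //.
by have := ltn_ord l; lia.
Qed.

(** Represents b((2x + t x^2)^r); it serves both for [iota] and for [a]. *)
Definition sq_poly (b : F -> K) r x : {poly K} :=
  \poly_(i < r.+1) (b (x ^+ (r + i)) * ('C(r, i) * 2 ^ (r - i))%:R).

Lemma sq_polyE b r x (t : nat) : additive_map b ->
  (sq_poly b r x).[t%:R] = b ((x *+ 2 + x ^+ 2 *+ t) ^+ r).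
Proof.
move=> b_add; rewrite horner_poly exprDn (additive_map_sum b_add).
apply: eq_bigr => i _.
have -> : (x *+ 2) ^+ (r - i) * (x ^+ 2 *+ t) ^+ i *+ 'C(r, i) =
    x ^+ (r + i) *+ ('C(r, i) * 2 ^ (r - i) * t ^ i).
  rewrite !exprMn_n mulrnAl mulrnAr -exprM -exprD -!mulrnA; congr (_ ^+ _ *+ _).
    by have := ltn_ord i; lia.
  by ring.
by rewrite (additive_mapMn b_add) -natrX !mulr_natr -mulrnA.
Qed.

(** In (2x + t x^2)^r the coefficient of t^j is a multiple of x^(r+j): each power of t raises the
    degree by one. *)
Lemma pow_span_sq k g (q : F -> {poly K}) :
  (forall x (t : nat), (q x).[t%:R] = g (x *+ 2 + x ^+ 2 *+ t)) ->
  pow_span k g -> forall j, pow_span (k + j) (fun x => (q x)`_j).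
Proof.
move=> qE [lam G] j.
have qP x : q x = \sum_(l < k)
    lam l *: (sq_poly iota (k - l.+1) x * sq_poly a l.+1 x).
  apply: (poly_eq_on_nat charK) => t; rewrite qE G horner_sum; apply: eq_bigr => l _.
  rewrite hornerZ hornerM (sq_polyE _ _ _ (additive_rmorph iota)) (sq_polyE _ _ _ a_add).
  by rewrite rmorphXn /= mulrA.
apply: (@pow_span_ext _ (fun x => \sum_(l < k)
    lam l * (sq_poly iota (k - l.+1) x * sq_poly a l.+1 x)`_j)) => [x|].
  by rewrite qP coef_sum; apply: eq_bigr => l _; rewrite coefZ.
apply: pow_span_sum => l _; apply: pow_spanZ.
apply: (@pow_span_ext _ (fun x => \sum_(i < j.+1)
  (sq_poly iota (k - l.+1) x)`_i * (sq_poly a l.+1 x)`_(j - i))) => [x|].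
  by rewrite coefM.
apply: pow_span_sum => i _.
rewrite /sq_poly; set r := (k - l.+1)%N.
case: (ltnP i r.+1) => [ir|ir]; last first.
  by apply: pow_span_ext (pow_span0 _) => x; rewrite coef_poly ltnNge ir mul0r.
case: (ltnP (j - i) l.+2) => [jl|jl]; last first.
  by apply: pow_span_ext (pow_span0 _) => x; rewrite [X in _ * X]coef_poly ltnNge jl mulr0.
apply: (@pow_span_ext _ (fun x => (('C(r, i) * 2 ^ (r - i))%:R *
   ('C(l.+1, j - i) * 2 ^ (l.+1 - (j - i)))%:R) *
   (iota x ^+ (r + i) * a (x ^+ (l.+1 + (j - i)))))) => [x|].
  by rewrite !coef_poly ir jl rmorphXn /=; ring.
apply/pow_spanZ/pow_span_pow; first by [].
by have := ltn_ord l; have := ltn_ord i; rewrite /r; lia.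
Qed.

End MonomialSpan.

Lemma sum_even (V : nmodType) n (G : nat -> V) :
  \sum_(l < n.*2.+1) (if odd l then 0 else G l) = \sum_(j < n.+1) G j.*2.
Proof.
elim: n => [|n IH]; first by rewrite !big_ord_recr !big_ord0.
by rewrite doubleS 2!big_ord_recr /= IH [RHS]big_ord_recr /= odd_double addr0.
Qed.

(** * The case kappa = 2 *)

Section KappaTwo.
Variables (F K : fieldType) (iota : {rmorphism F -> K}).
Hypothesis charK : [pchar K] =i pred0.
Variables (n : nat) (A : ('I_n -> F) -> K).
Hypothesis A_add : n_additive A.
Hypothesis sqA : forall x : F,
  A (fun=> x ^+ 2) = 2 * iota x ^+ n * A (fun=> x).

Let pow2_neq2 k : k != 1%N -> 2 ^+ k != 2 :> K.
Proof. by move=> k1; rewrite -[X in _ != X]expr1 (expr2_inj_char0 charK). Qed.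

Lemma taylor0_eq0 x : taylor A 0 x = 0.
Proof.
apply: (taylor_vanish charK A_add sqA (M := 1)) => // -[|k] // _ /eqP.
by rewrite eq_sym (negPf (pow2_neq2 _)).
Qed.

(** Strong induction on the recurrence: T_0 = 0, T_1 is the generator, and 2^m - 2 is invertible for
    every other m. *)
Lemma taylor_span m : (m <= n)%N -> pow_span iota (taylor A 1) m (taylor A m).
Proof.
elim/ltn_ind: m => m IH mn.
have [m0|m0] := eqVneq m 0%N.
  by rewrite m0; apply: pow_span_ext (pow_span0 _ _ _) => x; rewrite taylor0_eq0.
have [m1|m1] := eqVneq m 1%N.
  apply: pow_span_ext (pow_span_pow iota (taylor A 1) (m := m) (r := 0) (l := 1) _ _) => //.
  by move=> x; rewrite mul1r expr1 m1.
have c0 : 2 ^+ m - 2 != 0 :> K by rewrite subr_eq0 pow2_neq2.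
apply: (@pow_span_ext _ _ _ _ _ (fun x => (2 ^+ m - 2)^-1 *
  (2 * (\sum_(i < m) 'C(n, i.+1)%:R * (iota x ^+ i.+1 * taylor A (m - i.+1) x))
   + (-1) * \sum_(k < m) (taylor_sq A k x)`_(m - k)))) => [x|].
  have e := taylor_coef_eq_le charK A_add sqA x mn.
  apply: (mulfI c0); rewrite e mulVKf // mulN1r; congr (_ * _ - _).
  by apply: eq_bigr => i _; ring.
apply/pow_spanZ/pow_spanD; apply/pow_spanZ; apply: pow_span_sum => i _.
  apply: pow_spanZ; have im := ltn_ord i.
  rewrite -[X in pow_span _ _ X](subnK im); apply/pow_spanM/IH; lia.
have im := ltn_ord i; rewrite -[X in pow_span _ _ X](subnKC (ltnW im)).
apply: (pow_span_sq charK (taylor1_additive A_add)).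
  by move=> x t; exact: taylor_sqE.
by apply: IH => //; exact: leq_trans (ltnW im) mn.
Qed.

(** A (1 + t, ..., 1 + t) = (1 + t)^n A (1, ..., 1), and A (1, ..., 1) = T_0 = 0. *)
Lemma taylor1_1 : taylor A 1 1 = 0.
Proof.
have -> : taylor A 1 1 = (line_poly A (fun=> 1) (fun=> 1))`_1 by [].
suff -> : line_poly A (fun=> 1) (fun=> 1) = 0 by rewrite coef0.
apply: (poly_eq_on_nat charK) => t; rewrite (line_polyE A_add) horner0.
have -> : (fun=> 1 + 1 *+ t) = (fun i : 'I_n => (1 : F) *+ t.+1).
  by apply: functional_extensionality => i; rewrite mulrS.
by rewrite (n_additive_scale A_add) -(taylor0 A_add 0) taylor0_eq0 mul0rn.
Qed.

Lemma diagonal_derivation_sum : exists (a : F -> K) (lam : 'I_n -> K),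
  higher_derivation iota (2 * n - 1) a /\
  forall x, A (fun=> x) = \sum_(j < n) lam j * iota x ^+ (n - j.+1) * a (x ^+ j.+1).
Proof.
have [lam Alam] := taylor_span (leqnn n).
(* With all coefficients zero the relation below would be trivial; but then the diagonal of [A] is
   zero and a = 0 serves. *)
have [/forallP lam0|] := boolP [forall l : 'I_n, lam l == 0].
  exists (fun=> 0), (fun=> 0); split.
    exact: (@higher_derivation_leq _ _ iota 0).
  move=> x; rewrite -(taylor_max A) Alam !big1 // => l _; first by rewrite mul0r mul0r.
  by rewrite (eqP (lam0 l)) !mul0r.
rewrite negb_forall => /existsP[l0 lam_neq0].
exists (taylor A 1), (fun l => lam l); split; last by move=> x; rewrite -(taylor_max A).
rewrite mul2n.
(* [nu l] is the coefficient of x^(n-l) a(x^l), one index off from [lam]. In [mu], f(x^2)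
   contributes nu_(l/2) at even l, and 2 x^n f(x) contributes 2 nu_l. *)
pose nu l := if (0 < l <= n)%N then lam l.-1 else 0.
pose mu l := (if odd l then 0 else nu l./2) - 2 * nu l.
have Anu x : A (fun=> x) = \sum_(l < n.+1) nu l * iota x ^+ (n - l) * taylor A 1 (x ^+ l).
  rewrite -(taylor_max A) Alam big_ord_recl /= {1}/nu /= !mul0r add0r.
  by apply: eq_bigr => l _; rewrite /nu /bump /= ltn_ord.
apply: (higher_derivation_of_relation charK (mu := mu) (taylor1_additive A_add) taylor1_1).
  move=> x; rewrite /mu.
  transitivity (\sum_(l < n.*2.+1)
      (if odd l then 0 else nu l./2 * iota x ^+ (n.*2 - l) * taylor A 1 (x ^+ l)) -
    \sum_(l < n.*2.+1) 2 * nu l * iota x ^+ (n.*2 - l) * taylor A 1 (x ^+ l)).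
    rewrite -sumrB; apply: eq_bigr => l _.
    by case: ifP => _; rewrite !mulrBl ?mul0r.
  rewrite (sum_even n (fun l => nu l./2 * iota x ^+ (n.*2 - l) * taylor A 1 (x ^+ l))).
  apply/eqP; rewrite subr_eq0; apply/eqP.
  transitivity (A (fun=> x ^+ 2)).
    rewrite Anu; apply: eq_bigr => l _.
    by rewrite doubleK -doubleB -!mul2n rmorphXn -!exprM.
  rewrite sqA Anu mulr_sumr.
  rewrite (big_ord_widen n.*2.+1 (fun l =>
    2 * iota x ^+ n * (nu l * iota x ^+ (n - l) * taylor A 1 (x ^+ l)))); last first.
    by rewrite ltnS -addnn leq_addr.
  rewrite big_mkcond; apply: eq_bigr => l _; rewrite ltnS; case: leqP => [ln|nl].
    have -> : (n.*2 - l = n + (n - l))%N by lia.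
    by rewrite exprD; ring.
  by rewrite /nu [(l <= n)%N]leqNgt nl andbF !(mulr0, mul0r).
have exnu : exists l, (0 < l <= n)%N && (nu l != 0).
  by exists l0.+1; rewrite /nu /= ltn_ord.
have bnd l : (0 < l <= n)%N && (nu l != 0) -> (l <= n)%N by case/andP=> /andP[].
(* For the largest L with nu_L nonzero, 2L > L gives nu_(2L) = 0, hence mu_(2L) = nu_L is
   nonzero. *)
case: (ex_maxnP exnu bnd) => L /andP[/andP[L1 L2] nuL] Lmax.
exists L.*2; first by rewrite double_gt0 L1 leq_double.
rewrite /mu odd_double doubleK.
have -> : nu L.*2 = 0; last by rewrite mulr0 subr0.
apply/eqP/negbNE/negP => nz; have := Lmax L.*2; rewrite nz andbT.
have -> : (0 < L.*2 <= n)%N by move: nz; rewrite /nu; case: ifP => //; rewrite eqxx.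
by move=> /(_ isT); lia.
Qed.

End KappaTwo.

(** * The Leibniz defect, for kappa = 2^n *)

Section LeibnizDefect.
Variables (F K : fieldType) (iota : {rmorphism F -> K}) (n : nat).
Variable A : ('I_n.+1 -> F) -> K.
Hypothesis A_add : n_additive A.

(** Has the form of the summand in (iv), so that [sum_perm_eq0] reduces the symmetrized identity to
    the diagonal. *)
Definition leibniz_defect (v : 'I_n.+2 -> F) : K :=
  let y := fun k : nat => v (inord k) in
  A (fun i => if val i == 0%N then y 0%N * y 1%N else y i.+1)
  - iota (y 0%N) * A (fun i => y i.+1)
  - iota (y 1%N) * A (fun i => if val i == 0%N then y 0%N else y i.+1).

Lemma leibniz_defect_additive : n_additive leibniz_defect.
Proof.
pose tl (v : 'I_n.+2 -> F) := fun i : 'I_n.+1 => v (inord i.+1).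
pose hd1 (v : 'I_n.+2 -> F) z := upd (tl v) ord0 z.
have defE v : leibniz_defect v =
    A (hd1 v (v (inord 0) * v (inord 1))) - iota (v (inord 0)) * A (tl v)
    - iota (v (inord 1)) * A (hd1 v (v (inord 0))).
  by congr (A _ - _ - _ * A _); apply: functional_extensionality => i;
     rewrite /hd1 /upd -val_eqE.
have updE k m v z : (k < n.+2)%N -> (m < n.+2)%N ->
    upd v (inord k : 'I_n.+2) z (inord m) = if m == k then z else v (inord m) :> F.
  by move=> kn mn; rewrite /upd -val_eqE /= !inordK.
have tl_updE k v z i : (k < n.+2)%N ->
    tl (upd v (inord k) z) i = if i.+1 == k then z else tl v i.
  by move=> kn; rewrite /tl updE // ltnS.
have hd1_upd v z y k : (k < 2)%N -> hd1 (upd v (inord k) z) y = hd1 v y.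
  move=> k2; apply: functional_extensionality => i; rewrite /hd1 {1 3}/upd.
  case: ifP => // /negbT; rewrite -val_eqE /= => i0.
  by rewrite tl_updE; [case: eqP => //; lia|lia].
move=> v p u w; rewrite !defE -(inord_val p).
(* Variable 0 is absent from [tl] and variable 1 is its head, so both are treated apart; variable k
   + 2 sits in slot k + 1 of all three terms. *)
move: (val p) (ltn_ord p) => {p} [|[|k]] kn.
- have tlE z : tl (upd v (inord 0) z) = tl v.
    by apply: functional_extensionality => i; rewrite tl_updE.
  by rewrite !hd1_upd // !tlE !updE //= mulrDl !A_add rmorphD; ring.
- have tlE z : tl (upd v (inord 1) z) = hd1 v z.
    by apply: functional_extensionality => i; rewrite tl_updE // /hd1 /upd -val_eqE.
  by rewrite !hd1_upd // !tlE !updE //= mulrDr !A_add rmorphD; ring.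
have tlE z : tl (upd v (inord k.+2) z) = upd (tl v) (inord k.+1) z.
  apply: functional_extensionality => i.
  by rewrite tl_updE // /upd -val_eqE /= inordK.
have hdE z y : hd1 (upd v (inord k.+2) z) y = upd (hd1 v y) (inord k.+1) z.
  apply: functional_extensionality => i; rewrite /hd1 tlE /upd.
  by rewrite -!val_eqE /= inordK //; case: eqP => // ->.
by rewrite !hdE !tlE !updE //= !A_add; ring.
Qed.

End LeibnizDefect.

Theorem mainTheorem1 (F K : fieldType) (iota : {rmorphism F -> K})
  (charF : [pchar F] =i pred0) (charK : [pchar K] =i pred0)
  (n : nat) (n_pos : (0 < n)%N) (kappa : K) (f : F -> K)
  (f_mon : gen_monomial n f)
  (f_eq : forall x : F, f (x ^+ 2) = kappa * iota x ^+ n * f x) :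
  ((forall k : nat, (k <= n)%N -> kappa != 2 ^+ k) -> forall x, f x = 0) /\
  (kappa = 1 -> forall x, f x = f 1 * iota x ^+ n) /\
  (kappa = 2 ->
     exists (a : F -> K) (lam : 'I_n -> K),
       higher_derivation iota (2 * n - 1) a /\
       forall x, f x = \sum_(j < n) lam j * iota x ^+ (n - j.+1) * a (x ^+ j.+1)) /\
  (kappa = 2 ^+ n ->
     exists A : ('I_n -> F) -> K,
       n_additive A /\ symmetric_map A /\ (forall x, f x = A (fun _ => x)) /\
       forall (x : 'I_n.+1 -> F),
         \sum_(s : 'S_n.+1)
           (let y := fun k : nat => x (s (inord k)) in
            A (fun i : 'I_n => if val i == 0%N then y 0%N * y 1%N else y i.+1)
            - iota (y 0%N) * A (fun i : 'I_n => y i.+1)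
            - iota (y 1%N) * A (fun i : 'I_n => if val i == 0%N then y 0%N else y i.+1))
         = 0).
Proof.
case: f_mon => A [A_add [A_sym fA]].
have sqA x : A (fun=> x ^+ 2) = kappa * iota x ^+ n * A (fun=> x).
  by rewrite -!fA f_eq.
split=> [kn x|].
  rewrite fA; apply: (diagonal_vanish charK A_add sqA) => k /kn.
  by move=> + e; rewrite e eqxx.
split=> [k1 x|].
  (* Subtracting f(1) x^n, itself a solution for kappa = 1, keeps the equation and makes T_0 = g(1,
     ..., 1) vanish; k = 0 is the only exceptional index. *)
  pose g (v : 'I_n -> F) := A v - f 1 * \prod_i iota (v i).
  have g_const y : g (fun=> y) = f y - f 1 * iota y ^+ n.
    by rewrite /g prodr_const card_ord -fA.
  have g_add : n_additive g.
    move=> v i u w.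
    have pE z : \prod_j iota (upd v i z j) = iota z * \prod_(j | j != i) iota (v j).
      rewrite (bigD1 i) //= /upd eqxx; congr (_ * _).
      by apply: eq_bigr => j /negPf ->.
    by rewrite /g A_add !pE rmorphD; ring.
  have sqg y : g (fun=> y ^+ 2) = kappa * iota y ^+ n * g (fun=> y).
    by rewrite !g_const f_eq k1 rmorphXn -exprM mulnC exprM; ring.
  apply/eqP; rewrite -subr_eq0 -g_const; apply/eqP.
  apply: (diagonal_vanish charK g_add sqg) => k _; rewrite k1 => /eqP.
  rewrite -[1](expr0 2) (expr2_inj_char0 charK) => /eqP <- y.
  by rewrite (taylor0 g_add) g_const rmorph1 expr1n mulr1 subrr.
split=> [k2|kn].
  have [|a [lam [ha fE]]] := diagonal_derivation_sum charK A_add (iota := iota).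
    by move=> y; rewrite sqA k2.
  by exists a, lam; split=> // x; rewrite fA.
exists A; split=> //; split=> //; split=> //.
case: n n_pos A A_add A_sym fA sqA f_eq kn => // n _ A A_add A_sym fA sqA _ kn x.
(* On the diagonal the defect is A (y^2, y, ..., y) - 2 y A (y, ..., y), which [diagonal_leibniz]
   annihilates. *)
apply: (sum_perm_eq0 (leibniz_defect_additive iota A_add)) => y.
have := diagonal_leibniz charK A_add sqA A_sym kn y ord0.
rewrite /leibniz_defect.
have -> : (fun i : 'I_n.+1 => if val i == 0%N then y * y else y) = upd (fun=> y) ord0 (y ^+ 2).
  by apply: functional_extensionality => i; rewrite /upd -val_eqE.
have -> : (fun i : 'I_n.+1 => if val i == 0%N then y else y) = (fun=> y).
  by apply: functional_extensionality => i; case: ifP.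
by move=> ->; ring.
Qed.
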